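(* Let $u, v \ge 1$ be integers, let $X = \{x_i\}_{i=1}^u$ (the S samples) and $Y = \{y_j\}_{j=1}^v$ (the L samples) be finite families of positive real numbers, and let $q > 0$ be the leverage allocating parameter. For a real leverage degree $\alpha$, let $\hat{\mu}$ be the leverage-based answer computed from $X$, $Y$, $q$ and $\alpha$ (defined in the context). Then $\hat\mu$ is given by the following function of $\alpha$: $$\hat{\mu} = f(\alpha) = k\alpha + c,$$ where $$k = \left( \frac{\left(\sum_i x_i^2 + \sum_j y_j^2\right)\sum_i x_i - \sum_i x_i^3}{\left(1 + \frac{v}{qu}\right)\left(u\left(\sum_i x_i^2 + \sum_j y_j^2\right) - \sum_i x_i^2\right)} + \frac{v \sum_j y_j^3}{(qu+v)\sum_j y_j^2} \right) - \frac{1}{u+v}\left(\sum_i x_i + \sum_j y_j\right)$$ and $$c = \frac{1}{u+v}\left(\sum_i x_i + \sum_j y_j\right),$$ with all sums over $i$ from $1$ to $u$ and all sums over $j$ from $1$ to $v$.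
   Context: Let $T = \sum_{i=1}^u x_i^2 + \sum_{j=1}^v y_j^2$. The leverage-based answer $\hat\mu$ is defined as follows. Original leverage scores: each S sample $x_i$ has score $1 - x_i^2/T$, and each L sample $y_j$ has score $y_j^2/T$. Theoretical leverage sums: the total leverages $levSum_S$ of the S samples and $levSum_L$ of the L samples are determined by the two constraints $levSum_S + levSum_L = 1$ and $\dfrac{levSum_S}{levSum_L} = q\,\dfrac{u}{v}$. Normalization: the normalization factor $fac_S$ is the sum of the original scores of all S samples divided by $levSum_S$, and $fac_L$ is the sum of the original scores of all L samples divided by $levSum_L$. The (normalized) leverage $lev$ of an S sample (respectively an L sample) is its original score divided by $fac_S$ (respectively $fac_L$). Re-weighted probabilities: each sample in $X$ or $Y$ with normalized leverage $lev$ has $prob = \alpha\, lev + (1-\alpha)\dfrac{1}{u+v}$. Leverage-based answer: $\hat\mu = \sum_{i=1}^u x_i \cdot prob_{x_i} + \sum_{j=1}^v y_j \cdot prob_{y_j}$. *)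

(* Defs.v *)
From mathcomp Require Import all_boot all_order all_algebra.

Set Implicit Arguments.
Unset Strict Implicit.
Unset Printing Implicit Defensive.

Import Order.TTheory GRing.Theory Num.Theory.
Local Open Scope ring_scope.

Section Leverage.

Variables (R : realFieldType) (u v : nat).
Variables (x : 'I_u -> R) (y : 'I_v -> R).

Definition sum_squares : R := \sum_(i < u) x i ^+ 2 + \sum_(j < v) y j ^+ 2.

Definition score_S (i : 'I_u) : R := 1 - x i ^+ 2 / sum_squares.

Definition score_L (j : 'I_v) : R := y j ^+ 2 / sum_squares.

(* Division by zero is 0 in MathComp; for q, u, v > 0 the second constraint
   therefore still forces levSumL != 0. *)
Definition leverage_sums (q levSumS levSumL : R) : Prop :=
  levSumS + levSumL = 1 /\ levSumS / levSumL = q * (u%:R / v%:R).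

Definition fac_S (levSumS : R) : R := (\sum_(i < u) score_S i) / levSumS.

Definition fac_L (levSumL : R) : R := (\sum_(j < v) score_L j) / levSumL.

Definition lev_S (levSumS : R) (i : 'I_u) : R := score_S i / fac_S levSumS.

Definition lev_L (levSumL : R) (j : 'I_v) : R := score_L j / fac_L levSumL.

Definition prob (alpha lev : R) : R :=
  alpha * lev + (1 - alpha) * (1 / (u + v)%:R).

Definition weighted_sum (alpha levSumS levSumL : R) : R :=
  \sum_(i < u) x i * prob alpha (lev_S levSumS i) +
  \sum_(j < v) y j * prob alpha (lev_L levSumL j).

(* The leverage sums are specified only through their constraints, so the
   answer is a relation: mu is the answer obtained from some solution of them. *)
Definition leverage_answer (q alpha mu : R) : Prop :=
  exists levSumS levSumL : R,
    leverage_sums q levSumS levSumL /\ mu = weighted_sum alpha levSumS levSumL.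

End Leverage.

(* Main.v *)
(* The two constraints determine the leverage sums, as [q u / (q u + v)] and
   [v / (q u + v)]; with these fixed, each probability is affine in [alpha]. *)
Require Import Defs.
From mathcomp Require Import all_boot all_order all_algebra.
From mathcomp Require Import ring lra.

Set Implicit Arguments.
Unset Strict Implicit.
Unset Printing Implicit Defensive.

Import Order.TTheory GRing.Theory Num.Theory.
Local Open Scope ring_scope.

(** Uniqueness of the leverage sums ([leverage_sumsP]) turns the relation [leverage_answer] into a
    function of [alpha]. Each normalization factor is constant on its class, so [sum_mul_prob]
    splits a class total into [alpha] times a score-weighted mean, scaled by the leverage sum, plus
    [1 - alpha] times a uniform part. The uniform parts add up to [(1 - alpha) * c], which gives [c]
    and the [- c] inside [k]. Clearing [sum_squares] from the score sums gives the two fractions of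
    [k], the factor [1 + v / (q u)] being the inverse of the S leverage sum. *)

Lemma leverage_sumsP (R : realFieldType) (u v : nat) (q a b : R) :
  (0 < u)%N -> (0 < v)%N -> 0 < q ->
  leverage_sums u v q a b <->
    a = q * u%:R / (q * u%:R + v%:R) /\ b = v%:R / (q * u%:R + v%:R).
Proof.
move=> u_gt0 v_gt0 q_gt0.
have U_gt0 : 0 < u%:R :> R by rewrite ltr0n.
have V_gt0 : 0 < v%:R :> R by rewrite ltr0n.
have qU_gt0 : 0 < q * u%:R by rewrite mulr_gt0.
have V_neq0 := lt0r_neq0 V_gt0.
have D_neq0 : q * u%:R + v%:R != 0 by rewrite lt0r_neq0 ?addr_gt0.
split=> [[ab1 rab]|[-> ->]]; last first.
  by split; field; rewrite ?D_neq0 ?V_neq0.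
(* With [b = 0] the ratio [a / b] would be [0] by convention, whereas the constraint makes it
   positive. *)
have b_neq0 : b != 0.
  apply/eqP=> b0; have : 0 < a / b by rewrite rab mulr_gt0 ?divr_gt0.
  by rewrite b0 invr0 mulr0 ltxx.
have av : a * v%:R = q * u%:R * b.
  have -> : a = a / b * b by rewrite divfK.
  by rewrite rab; field.
have aE : a = 1 - b by rewrite -ab1 addrK.
have bE : b = v%:R / (q * u%:R + v%:R).
  by apply/(canRL (mulfK D_neq0)); rewrite mulrDr mulrC -av aE; ring.
by split=> //; rewrite aE bE; field.
Qed.

Lemma sum_score_S (R : realFieldType) (u v : nat) (x : 'I_u -> R) (y : 'I_v -> R) :
  \sum_(i < u) score_S x y i =
  u%:R - (\sum_(i < u) x i ^+ 2) / sum_squares x y.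
Proof. by rewrite sumrB sumr_const card_ord -mulr_suml. Qed.

Lemma sum_score_L (R : realFieldType) (u v : nat) (x : 'I_u -> R) (y : 'I_v -> R) :
  \sum_(j < v) score_L x y j = (\sum_(j < v) y j ^+ 2) / sum_squares x y.
Proof. by rewrite -mulr_suml. Qed.

Lemma sum_mul_score_S (R : realFieldType) (u v : nat) (x : 'I_u -> R) (y : 'I_v -> R) :
  \sum_(i < u) x i * score_S x y i =
  \sum_(i < u) x i - (\sum_(i < u) x i ^+ 3) / sum_squares x y.
Proof.
by rewrite mulr_suml -sumrB; apply: eq_bigr => i _; rewrite /score_S; ring.
Qed.

Lemma sum_mul_score_L (R : realFieldType) (u v : nat) (x : 'I_u -> R) (y : 'I_v -> R) :
  \sum_(j < v) y j * score_L x y j =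
  (\sum_(j < v) y j ^+ 3) / sum_squares x y.
Proof.
by rewrite mulr_suml; apply: eq_bigr => j _; rewrite /score_L; ring.
Qed.

(** The class size [n] is kept apart from [u] and [v] so that one statement serves both the S and
    the L samples. *)
Lemma sum_mul_prob (R : realFieldType) (u v n : nat) (alpha F : R) (z s : 'I_n -> R) :
  \sum_(i < n) z i * prob u v alpha (s i / F) =
  alpha * ((\sum_(i < n) z i * s i) / F)
    + (1 - alpha) * (1 / (u + v)%:R) * \sum_(i < n) z i.
Proof.
rewrite mulr_suml !mulr_sumr -big_split; apply: eq_bigr => i _ /=.
by rewrite /prob; ring.
Qed.

Lemma sum_sqr_gt0 (R : realFieldType) (n : nat) (z : 'I_n -> R) :
  (0 < n)%N -> (forall i, 0 < z i) -> 0 < \sum_(i < n) z i ^+ 2.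
Proof.
case: n z => // n z _ z_gt0.
rewrite big_ord_recl ltr_pwDl ?exprn_gt0 //.
by apply: sumr_ge0 => i _; rewrite sqr_ge0.
Qed.

Theorem theorem3 (R : realFieldType) (u v : nat) (hu : (1 <= u)%N) (hv : (1 <= v)%N)
    (x : 'I_u -> R) (y : 'I_v -> R)
    (hx : forall i, 0 < x i) (hy : forall j, 0 < y j)
    (q : R) (hq : 0 < q) :
  let k : R :=
    ((\sum_(i < u) x i ^+ 2 + \sum_(j < v) y j ^+ 2) * (\sum_(i < u) x i)
       - \sum_(i < u) x i ^+ 3)
      / ((1 + v%:R / (q * u%:R))
         * (u%:R * (\sum_(i < u) x i ^+ 2 + \sum_(j < v) y j ^+ 2)
            - \sum_(i < u) x i ^+ 2))
    + (v%:R * \sum_(j < v) y j ^+ 3)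
      / ((q * u%:R + v%:R) * \sum_(j < v) y j ^+ 2)
    - 1 / (u + v)%:R * (\sum_(i < u) x i + \sum_(j < v) y j) in
  let c : R := 1 / (u + v)%:R * (\sum_(i < u) x i + \sum_(j < v) y j) in
  forall alpha mu : R,
    leverage_answer x y q alpha mu <-> mu = k * alpha + c.
Proof.
move=> k c alpha mu.
have Sx2_gt0 := sum_sqr_gt0 hu hx; have Sy2_gt0 := sum_sqr_gt0 hv hy.
have U_gt0 : 0 < u%:R :> R by rewrite ltr0n.
have V_gt0 : 0 < v%:R :> R by rewrite ltr0n.
pose a : R := q * u%:R / (q * u%:R + v%:R).
pose b : R := v%:R / (q * u%:R + v%:R).
(* Both directions reduce to this identity: [a], [b] is the only solution of the constraints, and
   serves as the witness. *)
suff sumE : weighted_sum x y alpha a b = k * alpha + c.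
  split=> [[a' [b' [/leverage_sumsP[]// -> -> ->]]]//|->].
  by exists a, b; split=> //; apply/leverage_sumsP.
rewrite /weighted_sum /lev_S /lev_L !sum_mul_prob.
rewrite sum_mul_score_S sum_mul_score_L /fac_S /fac_L sum_score_S sum_score_L.
rewrite /k /c /a /b /sum_squares natrD.
have qU_gt0 : 0 < q * u%:R by rewrite mulr_gt0.
have U_ge1 : 1 <= u%:R :> R by rewrite ler1n.
move: Sx2_gt0 Sy2_gt0 U_gt0 V_gt0 qU_gt0 U_ge1.
(* What remains is an identity of rational functions; only the signs of the quantities in
   denominators matter. *)
move: (\sum_(i < u) x i ^+ 2) (\sum_(j < v) y j ^+ 2) (u%:R : R) (v%:R : R).
move=> A B U V A_gt0 B_gt0 U_gt0 V_gt0 qU_gt0 U_ge1.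
(* This is the S score sum times [A + B]. It equals [(U - 1) * A + U * B], so [B > 0] keeps it
   positive even when [U = 1]. *)
have D_gt0 : 0 < U * (A + B) - A by nra.
field.
by do ?[apply/andP; split]; apply: lt0r_neq0 => //; apply: addr_gt0.
Qed.
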